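(* Let $p$ be a prime, $n\in\mathbb{N}$, and let $k$ be a field of characteristic $p$. Let $f(X)\in k[X]$ be a monic separable additive polynomial of degree $p^n$ such that $\mathcal{G}_f\subseteq k$. Let $K/k$ be an elementary abelian $p$-extension of degree $p^n$. Then there exist $y\in K$ and $u\in k$ such that $K=k(y)$ and $f(y)=u$.
   Context: A polynomial $f(X)\in k[X]$ is additive if $f(x+y)=f(x)+f(y)$ for all $x,y$ in a fixed algebraic closure $\bar k$ of $k$; thus a monic separable additive polynomial of degree $p^n$ has the form $f(X)=X^{p^n}+a_{n-1}X^{p^{n-1}}+\cdots+a_1X^p+a_0X$ with $a_i\in k$ and $a_0\neq 0$. The set of its roots is $\mathcal{G}_f:=\{\xi\in\bar k\mid f(\xi)=0\}$. *)

(* Defs.v *)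
From mathcomp Require Import all_boot all_order all_fingroup all_algebra.
From mathcomp Require Import all_solvable all_field.

Set Implicit Arguments.
Unset Strict Implicit.
Unset Printing Implicit Defensive.

Import GRing.Theory.

Local Open Scope ring_scope.

(* As kbar is a closedFieldType, it is an algebraic closure of k along iota    *)
(* as soon as it is algebraic over the image of iota.                          *)
Definition is_alg_closure (k : fieldType) (kbar : closedFieldType)
    (iota : {rmorphism k -> kbar}) : Prop :=
  forall x : kbar, algebraicOver iota x.

Definition additive_poly (k : fieldType) (kbar : closedFieldType)
    (iota : {rmorphism k -> kbar}) (f : {poly k}) : Prop :=
  forall x y : kbar,
    (map_poly iota f).[x + y] = (map_poly iota f).[x] + (map_poly iota f).[y].

Definition root_set (k : fieldType) (kbar : closedFieldType)
    (iota : {rmorphism k -> kbar}) (f : {poly k}) : {pred kbar} :=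
  [pred xi : kbar | root (map_poly iota f) xi].

Definition elem_abelian_ext (p : nat) (k : fieldType)
    (K : splittingFieldType k) : bool :=
  galois 1%AS {:K}%AS && (p.-abelem 'Gal({:K}%VS / 1%VS))%g.

(* Main.v *)
Require Import Defs.
From HB Require Import structures.
From mathcomp Require Import all_boot all_order all_fingroup all_algebra.
From mathcomp Require Import all_solvable all_field.

Set Implicit Arguments.
Unset Strict Implicit.
Unset Printing Implicit Defensive.

Import GRing.Theory.

Local Open Scope ring_scope.

(** The roots of [f] form a finite additive subgroup of [k], killed by [p], of
    order [p ^ n].  The group [Gal(K/k)] is elementary abelian of the same
    order, so there is an isomorphism [phi] from it onto the group of roots
    ([abelem_to_zmod]).  The Galois group acts trivially on [k], hence [phi] is
    an additive 1-cocycle with values in [K].  By the additive form of Hilbert's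
    Theorem 90 ([additive_Hilbert90]) it is a coboundary: there is [y] in [K]
    with [sigma y = y + phi sigma] for every [sigma] in the Galois group.

    This [y] is the generator.  As [phi] is injective, only the identity fixes
    [y], so [k(y) = K] by the Galois correspondence
    ([adjoin_trivial_stabiliser]).  As each [phi sigma] is a root of the
    additive polynomial [f], translation by it leaves [f] unchanged
    ([additive_poly_translate]), so [sigma (f y) = f (y + phi sigma) = f y] and
    [f y] lies in [k]. *)

Section ListedSubgroup.

Variables (V : zmodType) (s : seq V) (s_zmod : zmod_closed (mem s)).

(** The closure proof is a parameter of the type because the group operations
    below are computed from it: instance inference can then recover it from the
    type alone. *)
Definition listed_subgroup (_ : zmod_closed (mem s)) : Type := seq_sub s.
Local Notation S := (listed_subgroup s_zmod).

HB.instance Definition _ := Finite.copy S (seq_sub s).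

Let zero : S := SeqSub (proj1 s_zmod).
Let add (x y : S) : S :=
  SeqSub (proj2 (GRing.zmod_closedD s_zmod) _ _ (ssvalP x) (ssvalP y)).
Let opp (x : S) : S := SeqSub (GRing.zmod_closedN s_zmod (ssvalP x)).

Fact listed_addA : associative add.
Proof. by move=> x y z; apply/val_inj; exact: addrA. Qed.
Fact listed_add0 : left_id zero add.
Proof. by move=> x; apply/val_inj; exact: add0r. Qed.
Fact listed_addN : left_inverse zero opp add.
Proof. by move=> x; apply/val_inj; exact: addNr. Qed.

HB.instance Definition _ :=
  Finite_isGroup.Build S listed_addA listed_add0 listed_addN.

Lemma ssval_mulg (x y : S) : ssval (x * y)%g = ssval x + ssval y.
Proof. by []. Qed.

Lemma ssval_expg (x : S) m : ssval (x ^+ m)%g = ssval x *+ m.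
Proof. by elim: m => // m IHm; rewrite expgS ssval_mulg IHm mulrS. Qed.

Lemma abelem_listed_subgroup p :
  prime p -> {in s, forall a, a *+ p = 0} -> (p.-abelem [set: S])%g.
Proof.
move=> p_pr s_p; apply/abelemP => //; split=> [|x _].
  by apply/centsP => x _ y _; apply/val_inj; exact: addrC.
by apply/val_inj; rewrite /= ssval_expg s_p ?(valP x).
Qed.

End ListedSubgroup.

(** Elementary abelian groups of the same order are isomorphic; this transports
    the fact to an additive group that need not be finite, and of which only a
    finite subgroup is listed. *)
Lemma abelem_to_zmod (gT : finGroupType) (G : {group gT}) (p : nat)
    (V : zmodType) (s : seq V) :
    prime p -> (p.-abelem G)%g -> zmod_closed (mem s) ->
    {in s, forall a, a *+ p = 0} -> uniq s -> size s = #|G| ->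
  exists2 phi : gT -> V,
    {in G &, forall x y, phi (x * y)%g = phi x + phi y}
  & {in G &, injective phi} /\ {in G, forall x, phi x \in s}.
Proof.
move=> p_pr abelG s_zmod s_p s_uniq size_s.
have: G \isog [set: listed_subgroup s_zmod].
  rewrite (isog_abelem_card _ abelG) abelem_listed_subgroup //=.
  by rewrite cardsT [#|_|](card_seq_sub s_uniq) size_s.
case/isogP=> h /injmP inj_h _.
exists (fun x => ssval (h x)) => [x y Gx Gy|]; first by rewrite morphM.
split=> [x y Gx Gy eq_h | x _]; last exact: ssvalP.
by apply: inj_h => //; apply/val_inj.
Qed.

(** The automorphisms are linearly independent, so their sum does not vanish
    identically; a nonzero value of the trace is fixed by the Galois group and
    can be divided out. *)
Lemma galTrace_onto (F : fieldType) (L : splittingFieldType F)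
    (K E : {subfield L}) :
  galois K E -> exists2 c, c \in E & galTrace K E c = 1.
Proof.
move=> galKE.
have [||c Ec /= tr_c] := @gal_independent_contra _ _ E
  (fun x => x \in 'Gal(E / K)%g) (fun=> 1) 1%g.
- exact: group1.
- exact: oner_neq0.
have {}tr_c: galTrace K E c != 0.
  apply: contraNneq tr_c => tr0; rewrite -[X in _ == X]tr0.
  by apply/eqP/eq_bigr => x _; rewrite mul1r.
have /mem_fixedFieldP[Et fix_t] := galTrace_fixedField K Ec.
exists (c / galTrace K E c); first by rewrite rpred_div.
rewrite -[RHS](divff tr_c) [in RHS]/galTrace mulr_suml.
by apply: eq_bigr => x galx; rewrite rmorphM /= fmorphV /= fix_t.
Qed.

(** With [c] of trace 1, the averaged sum [b = - \sum_x a x * x c] works: the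
    cocycle relation turns [y b] into [b + a y * \sum_x x c]. *)
Lemma additive_Hilbert90 (F : fieldType) (L : splittingFieldType F)
    (K E : {subfield L}) (a : gal_of E -> L) :
    galois K E -> {in 'Gal(E / K)%g, forall x, a x \in E} ->
    {in 'Gal(E / K)%g &, forall x y : gal_of E, a (x * y)%g = y (a x) + a y} ->
  exists2 b, b \in E & {in 'Gal(E / K)%g, forall x : gal_of E, x b = b + a x}.
Proof.
move=> galKE Ea cocycle_a; have [c Ec tr_c] := galTrace_onto galKE.
exists (- \sum_(x in 'Gal(E / K)%g) a x * x c).
  by rewrite rpredN rpred_sum // => x galx; rewrite rpredM ?Ea ?memv_gal.
move=> y galy; apply: (addrI (\sum_(x in 'Gal(E / K)%g) a x * x c)).
rewrite addrA addrN add0r rmorphN rmorph_sum /=.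
(* Right translation by [y] in the untwisted sum and in the trace makes their
   terms match those of the image under [y], as [y (x c) = (x * y) c]. *)
rewrite (reindex_acts 'R _ galy) ?astabsR //= -sumrB.
rewrite -[RHS]mulr1 -tr_c /galTrace.
rewrite [in RHS](reindex_acts 'R _ galy) ?astabsR //=.
rewrite mulr_sumr; apply: eq_bigr => x galx.
by rewrite cocycle_a // rmorphM galM //= -mulrBl addrC addKr.
Qed.

Lemma closed_field_horner_eq0 (F : closedFieldType) (q : {poly F}) :
  (forall x, q.[x] = 0) -> q = 0.
Proof.
move=> q0; apply/eqP/negPn/negP => /closed_nonrootP[x].
by rewrite rootE q0 eqxx.
Qed.

Section AdditivePoly.

Variables (k : fieldType) (kbar : closedFieldType).
Variables (iota : {rmorphism k -> kbar}) (f : {poly k}).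
Hypothesis f_add : additive_poly iota f.

Lemma additive_poly_hornerD x y : f.[x + y] = f.[x] + f.[y].
Proof.
apply: (fmorph_inj iota).
by rewrite rmorphD /= -!horner_map rmorphD; exact: f_add.
Qed.

Lemma zmod_closed_root : zmod_closed [pred a | root f a].
Proof.
have f0 : f.[0] = 0.
  by apply: (addrI f.[0]); rewrite -additive_poly_hornerD !addr0.
split=> [|x y]; first by rewrite inE rootE f0.
rewrite !inE !rootE => /eqP fx /eqP fy.
by rewrite -[f.[x - y]]addr0 -[X in _ + X]fy -additive_poly_hornerD subrK fx.
Qed.

(** Additivity is known on values only; it becomes an identity of polynomials
    because a nonzero polynomial over the closure has a non-root. *)
Lemma additive_poly_translate a : root f a -> f \Po ('X + a%:P) = f.
Proof.
move/rootP=> fa; apply: (map_poly_inj iota).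
apply/eqP; rewrite -subr_eq0; apply/eqP/closed_field_horner_eq0 => x.
rewrite map_comp_poly rmorphD /= map_polyX map_polyC /= hornerD hornerN.
rewrite horner_comp !hornerE f_add horner_map fa rmorph0 addr0.
exact: subrr.
Qed.

End AdditivePoly.

(** A separable polynomial is the product of the distinct linear factors given
    by its roots in the closure; when these come from [k], injectivity of [iota]
    brings the whole factorization down to [k]. *)
Lemma split_roots_in_base (k : fieldType) (kbar : closedFieldType)
    (iota : {rmorphism k -> kbar}) (f : {poly k}) :
    f \is monic -> separable_poly f ->
    (forall xi, xi \in root_set iota f -> exists a, xi = iota a) ->
  exists2 s : seq k, uniq s & f = \prod_(a <- s) ('X - a%:P).
Proof.
move=> f_monic f_sep roots_k.
have [rs f_rs] := closed_field_poly_normal (map_poly iota f).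
rewrite lead_coef_map (monicP f_monic) rmorph1 scale1r in f_rs.
have [s def_rs]: exists s, rs = map iota s.
  have: {in rs, forall xi, exists a, xi = iota a}.
    by move=> xi rs_xi; apply: roots_k; rewrite inE f_rs root_prod_XsubC.
  elim: rs {f_rs} => [|xi rs IHrs] rs_k; first by exists [::].
  have [a ->] := rs_k xi (mem_head _ _).
  have [z rs_z|s ->] := IHrs; first by apply: rs_k; rewrite inE rs_z orbT.
  by exists (a :: s).
have f_s: f = \prod_(a <- s) ('X - a%:P).
  apply: (map_poly_inj iota); rewrite /= f_rs def_rs rmorph_prod big_map /=.
  by apply: eq_bigr => a _; rewrite rmorphB /= map_polyX map_polyC.
by exists s => //; rewrite -separable_prod_XsubC -f_s.
Qed.

(** The Galois group of [E] over [K(y)] is the stabiliser of [y]; if it is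
    trivial, its fixed field [K(y)] is all of [E]. *)
Lemma adjoin_trivial_stabiliser (F : fieldType) (L : splittingFieldType F)
    (K E : {subfield L}) (y : L) :
    galois K E -> y \in E ->
    (forall x, x \in 'Gal(E / K)%g -> x y = y -> x = 1%g) ->
  <<K; y>>%VS = E.
Proof.
move=> galKE Ey stab_y; have [sKE _ _] := and3P galKE.
have sKyE : (<<K; y>> <= E)%VS by apply/FadjoinP.
have galKyE : galois <<K; y>> E by rewrite (galoisS _ galKE) // subv_adjoin.
rewrite -[LHS](galois_fixedField galKyE).
apply/eqP; rewrite eqEsubv fixedField_bound; apply/subvP => z Ez.
apply/fixedFieldP => // x galx; suff ->: x = 1%g by rewrite gal_id.
apply: stab_y; first exact: subsetP (galS _ (subv_adjoin _ _)) _ galx.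
exact: fixed_gal sKyE galx (memv_adjoin _ _).
Qed.

Theorem theorem5p7 (p n : nat) (k : fieldType)
    (kbar : closedFieldType) (iota : {rmorphism k -> kbar})
    (f : {poly k}) (K : splittingFieldType k) :
  prime p ->
  p \in [pchar k] ->
  is_alg_closure iota ->
  f \is monic ->
  separable_poly f ->
  additive_poly iota f ->
  size f = (p ^ n).+1 ->
  (forall xi : kbar, xi \in root_set iota f -> exists a : k, xi = iota a) ->
  elem_abelian_ext p K ->
  \dim {:K} = (p ^ n)%N ->
  exists (y : K) (u : k),
    <<1; y>>%VS = {:K}%VS /\ (map_poly (in_alg K) f).[y] = u%:A.
Proof.
move=> p_pr p_char _ f_monic f_sep f_add size_f roots_k /andP[galK abelK] dimK.
have [s s_uniq f_s] := split_roots_in_base f_monic f_sep roots_k.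
have s_root a : (a \in s) = root f a by rewrite f_s root_prod_XsubC.
have size_s : size s = #|'Gal({:K} / 1)%g|.
  rewrite -(galois_dim galK) dimv1 divn1 dimK.
  by apply/succn_inj; rewrite -size_f f_s size_prod_XsubC.
have s_zmod : zmod_closed (mem s).
  have [s0 sB] := zmod_closed_root f_add.
  have eq_s : mem s =i [pred a | root f a] by exact: s_root.
  by split=> [|x y]; rewrite !eq_s; [exact: s0 | exact: sB].
have s_p : {in s, forall a, a *+ p = 0}.
  by move=> a _; rewrite -mulr_natr (pcharf0 p_char) mulr0.
have [phi phiM [phi_inj phi_s]] :=
  abelem_to_zmod p_pr abelK s_zmod s_p s_uniq size_s.
have fix_k (x : gal_of {:K}) (a : k) : x a%:A = a%:A by rewrite linearZ rmorph1.
(* On values in [k] the twisting by the Galois action disappears, and the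
   cocycle condition is that [phi] is a homomorphism. *)
have [||y _ y_phi] := @additive_Hilbert90 _ _ _ _ (fun x => (phi x)%:A) galK.
- by move=> x _; exact: memvf.
- by move=> x z galx galz /=; rewrite phiM // scalerDl fix_k.
have f_fixed x : x \in 'Gal({:K} / 1)%g ->
    x (map_poly (in_alg K) f).[y] = (map_poly (in_alg K) f).[y].
  move=> galx; have f_phi : root f (phi x) by rewrite -s_root phi_s.
  rewrite -horner_map -map_poly_comp /= (eq_map_poly (fix_k x)) y_phi //.
  rewrite -[in RHS](additive_poly_translate f_add f_phi) map_comp_poly.
  by rewrite horner_comp rmorphD /= map_polyX map_polyC !hornerE.
have /vlineP[u f_u] : (map_poly (in_alg K) f).[y] \in 1%VS.
  by rewrite -(galois_fixedField galK); apply/fixedFieldP; rewrite ?memvf.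
exists y, u; split=> //.
apply: adjoin_trivial_stabiliser galK (memvf y) _ => x galx fix_y.
have phi1: phi 1%g = 0.
  by apply: (addrI (phi 1%g)); rewrite -phiM // mulg1 addr0.
apply: phi_inj => //; apply: (fmorph_inj (in_alg K)).
by apply: (addrI y); rewrite /= -y_phi // fix_y phi1 scale0r addr0.
Qed.
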